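(* For every integer $k\ge 1$, the set of positive integers $m$ that have $F_{2k}$ in both their Zeckendorf and Chung-Graham decompositions (i.e., $F_{2k}\in Z(m)\cap CG(m)$) is $$\{nF_{2k}+\lfloor (n-1)\phi\rfloor F_{2k+1}+j\ :\ n\in\mathbb{N},\ 0\le j\le F_{2k-1}-1\},$$ where $\phi=(1+\sqrt5)/2$, $\mathbb{N}=\{1,2,3,\ldots\}$, and $j$ ranges over integers.
   Context: Fibonacci numbers: $F_0=0$, $F_1=1$, $F_{n+2}=F_{n+1}+F_n$. Zeckendorf decomposition: every positive integer $n$ is uniquely a sum $\sum_{i\ge 2} a_iF_i$ with $a_i\in\{0,1\}$, finitely many nonzero, and no two consecutive $a_i,a_{i+1}$ both equal to $1$. Chung-Graham decomposition: every positive integer $n$ is uniquely a sum $\sum_{i\ge 1}c_iF_{2i}$ with $c_i\in\{0,1,2\}$, finitely many nonzero, such that whenever $c_{i_1}=c_{i_2}=2$ with $i_1<i_2$, there is $j$ with $i_1<j<i_2$ and $c_j=0$. $Z(n)$ and $CG(n)$ denote the sets of all Fibonacci numbers appearing with nonzero coefficient in the Zeckendorf decomposition and the Chung-Graham decomposition of $n$, respectively. *)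

(* Defs.v *)
From HB Require Import structures.
From mathcomp Require Import all_boot all_order all_algebra.
From mathcomp Require Import classical_sets reals.
Set Implicit Arguments.
Unset Strict Implicit.
Unset Printing Implicit Defensive.
Import Order.TTheory GRing.Theory Num.Theory.

Local Open Scope nat_scope.

Fixpoint fib (n : nat) : nat :=
  match n with
  | 0 => 0
  | 1 => 1
  | (n'.+1 as p).+1 => fib p + fib n'
  end.

(* The sequence [a] is only meaningful from index 2 on: [a 0] and [a 1] are
   ignored. *)
Definition zeckendorf_decomposition (n : nat) (a : nat -> nat) : Prop :=
  [/\ forall i, 2 <= i -> a i \in [:: 0; 1],
      forall i, 2 <= i -> ~ (a i = 1 /\ a i.+1 = 1)
    & exists2 N, forall i, N <= i -> a i = 0
               & n = \sum_(2 <= i < N) a i * fib i].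

(* The sequence [c] is only meaningful from index 1 on: [c 0] is ignored. *)
Definition chung_graham_decomposition (n : nat) (c : nat -> nat) : Prop :=
  [/\ forall i, 1 <= i -> c i \in [:: 0; 1; 2],
      forall i1 i2, 1 <= i1 -> i1 < i2 -> c i1 = 2 -> c i2 = 2 ->
        exists2 j, i1 < j < i2 & c j = 0
    & exists2 N, forall i, N <= i -> c i = 0
               & n = \sum_(1 <= i < N) c i * fib (2 * i)].

Definition Z (n : nat) : set nat :=
  [set f | exists2 a, zeckendorf_decomposition n a
         & exists i, [/\ 2 <= i, a i != 0 & f = fib i]].

Definition CG (n : nat) : set nat :=
  [set f | exists2 c, chung_graham_decomposition n c
         & exists i, [/\ 1 <= i, c i != 0 & f = fib (2 * i)]].

Definition phi (R : realType) : R := ((1 + Num.sqrt 5) / 2)%R.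

(* Main.v *)
(* Write F = F_{2k}, G = F_{2k+1}, E = F_{2k-1}. Splitting a decomposition of m
   that contains F_{2k} at that position, and using
   F_{2k+i} = F_i G + F_{i-1} F on the digits above it, gives
   m = l + (x + 1) F + y G, where (x, y) is the value of the upper digits at the
   shifted weights (F_{i-1}, F_i).

   The number y - x phi is an expansion in powers of the conjugate of phi whose
   most significant digits are the lowest ones, so digit conditions become
   windows. A Zeckendorf tail gives y - x phi in ]-1, phi - 1[ and l < E. A
   Chung-Graham tail gives x phi - y in [0, phi[, improved to [0, 1[ when a 0
   must come before its first 2; then either l < E, or l < G and the improved
   window holds. Conversely, integer points in these windows are reached by
   peeling off one digit at a time.

   If m is split in both ways, comparing the two forces y - x phi <= 0 on the
   Zeckendorf side, i.e. y = floor (x phi). Conversely, if y = floor (x phi) and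
   l < E, both tails exist. *)
Require Import Defs.
From mathcomp Require Import all_boot all_order all_algebra.
From mathcomp Require Import boolp classical_sets reals.
From mathcomp Require Import zify ring lra.
Import Order.TTheory GRing.Theory Num.Theory.
Local Open Scope classical_set_scope.
Local Open Scope ring_scope.

Set Implicit Arguments.
Unset Strict Implicit.
Unset Printing Implicit Defensive.

Arguments fib : simpl never.

(** * Fibonacci identities and weighted digit sums *)

Lemma fibSS n : fib n.+2 = (fib n.+1 + fib n)%N.
Proof. by []. Qed.

Lemma fib_add m n :
  fib (m + n.+1) = (fib n.+1 * fib m.+1 + fib n * fib m)%N.
Proof.
elim: m n => [|m IHm] n; first by rewrite /= muln1 muln0 addn0.
by rewrite addSnnS IHm !fibSS; ring.
Qed.

Lemma fib_gt0 n : (0 < fib n.+1)%N.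
Proof. by elim: n => // n IHn; rewrite fibSS ltn_addr. Qed.

Lemma leq_fib n : (fib n <= fib n.+1)%N.
Proof. by case: n => // n; rewrite fibSS leq_addr. Qed.

(** The shift by two avoids the repetition [fib 1 = fib 2]. *)
Lemma fib_inj i j : fib i.+2 = fib j.+2 -> i = j.
Proof.
have lt_fib : {homo (fun n => fib n.+2) : m n / (m < n)%N}.
  apply: homo_ltn => [a b c|n]; first exact: ltn_trans.
  by rewrite [fib n.+3]fibSS -addn1 leq_add2l fib_gt0.
move=> eq_ij; case: (ltngtP i j) => // /lt_fib; lia.
Qed.

Lemma sum_fibSS N (d g : nat -> nat) :
  (\sum_(i < N) d i * fib (g i).+2 =
   \sum_(i < N) d i * fib (g i).+1 + \sum_(i < N) d i * fib (g i))%N.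
Proof. by rewrite -big_split /=; apply: eq_bigr => i _; rewrite -mulnDr. Qed.

(** The addition formula applied digit by digit: digits above position [n] matter only through two
    sums, which become the coefficients [y] and [x] of a splitting. *)
Lemma sum_fib_add n N (d g : nat -> nat) :
  (\sum_(i < N) d i * fib (n + (g i).+1) =
   (\sum_(i < N) d i * fib (g i).+1) * fib n.+1 +
   (\sum_(i < N) d i * fib (g i)) * fib n)%N.
Proof.
rewrite !big_distrl -big_split /=; apply: eq_bigr => i _.
by rewrite fib_add mulnDr !mulnA.
Qed.

Definition digit_cons (x : nat) (d : nat -> nat) (i : nat) : nat :=
  if i is j.+1 then d j else x.

Definition splice (p : nat) (b d : nat -> nat) (i : nat) : nat :=
  if (i < p)%N then b i else d (i - p)%N.

Lemma sum_shift p N (d w : nat -> nat) :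
  (\sum_(i < p + N) d i * w i =
   \sum_(i < p) d i * w i + \sum_(i < N) d (p + i) * w (p + i))%N.
Proof. by rewrite big_split_ord. Qed.

Lemma sum_pad p (d w : nat -> nat) :
  (forall i, p <= i -> d i = 0)%N ->
  forall N, (p <= N)%N ->
  (\sum_(i < N) d i * w i = \sum_(i < p) d i * w i)%N.
Proof.
move=> d0 N /subnKC <-; rewrite sum_shift [X in (_ + X)%N]big1 ?addn0 // => i _.
by rewrite d0 ?mul0n // leq_addr.
Qed.

Lemma sum_splice p N (b d w : nat -> nat) :
  (\sum_(i < p + N) splice p b d i * w i =
   \sum_(i < p) b i * w i + \sum_(i < N) d i * w (p + i))%N.
Proof.
rewrite sum_shift; congr addn; apply: eq_bigr => i _; congr muln.
  by rewrite /splice ltn_ord.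
by rewrite /splice ltnNge leq_addr addKn.
Qed.

(** * Zeckendorf digits *)

(* Digit [i] of a Zeckendorf sequence is the coefficient of [fib i.+2]. *)
Definition zeck_digits (b : nat -> nat) : Prop :=
  (forall i, b i <= 1)%N /\ (forall i, b i = 0 \/ b i.+1 = 0)%N.

Lemma zeckendorf_digits n a : zeckendorf_decomposition n a ->
  zeck_digits (fun i => a i.+2) /\
  exists2 N, (forall i, N <= i -> a i.+2 = 0)%N &
    n = (\sum_(i < N) a i.+2 * fib i.+2)%N.
Proof.
case=> adig asep [N a0 ->]; split; first split => i.
- by have := adig i.+2 isT; rewrite !inE => /orP[] /eqP->.
- have := adig i.+2 isT; have := adig i.+3 isT; have := asep i.+2 isT.
  rewrite !inE => nadj /orP[] /eqP a3 /orP[] /eqP a2; auto.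
  by case: nadj.
exists N.-1.-1 => [i leNi|]; first by apply: a0; lia.
by rewrite 2!big_add1 big_mkord.
Qed.

Lemma digits_zeckendorf b N : zeck_digits b ->
  (forall i, N <= i -> b i = 0)%N ->
  zeckendorf_decomposition (\sum_(i < N) b i * fib i.+2) (fun i => b i.-2).
Proof.
move=> [bdig bsep] b0; split.
- by move=> i _; rewrite !inE; have := bdig i.-2; case: (b _) => [|[]].
- by move=> [|[|i]] // _ /=; have := bsep i => -[->|->] [].
by exists N.+2 => [i leNi|]; [apply: b0; lia | rewrite 2!big_add1 big_mkord].
Qed.

Lemma zeck_digits0 : zeck_digits (fun=> 0%N).
Proof. by split=> // i; left. Qed.

Lemma zeck_digits_cons x d : zeck_digits d -> (x <= 1)%N ->
  x = 0%N \/ d 0%N = 0%N -> zeck_digits (digit_cons x d).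
Proof. by move=> [ddig dsep] x1 x0; split=> -[|i] /=. Qed.

Lemma zeck_digits_splice p b d : zeck_digits b -> zeck_digits d ->
  (forall i, p <= i.+1 -> b i = 0)%N -> zeck_digits (splice p b d).
Proof.
move=> [bdig bsep] [ddig dsep] b0; split=> i; rewrite /splice.
  by case: ifP.
case: (ltnP i p) => [lt_ip|le_pi].
  by case: ltnP => [_|le_pi]; [exact: bsep | left; exact: b0].
by rewrite ltnNge (leq_trans le_pi) //= subSn //.
Qed.

Lemma zeck_sum_lt b : zeck_digits b ->
  forall p, (\sum_(i < p) b i * fib i.+2 < fib p.+2)%N.
Proof.
move=> [bdig bsep] p.
(* Two consecutive bounds are carried, since a top digit 1 forces a 0 below it and leaves a sum two
   positions shorter. *)
suff: (\sum_(i < p) b i * fib i.+2 < fib p.+2 /\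
       \sum_(i < p.+1) b i * fib i.+2 < fib p.+3)%N by case.
elim: p => [|p [IH0 IH1]].
  by rewrite big_ord_recl !big_ord0 /fib /=; have := bdig 0%N; lia.
split=> //; rewrite big_ord_recr /=.
have [->|bp1] : b p.+1 = 0%N \/ b p.+1 = 1%N.
  by have := bdig p.+1; case: (b p.+1) => [|[|]]; auto.
  by rewrite mul0n addn0 (leq_trans IH1) ?leq_fib.
have [bp0|] := bsep p; last by rewrite bp1.
rewrite big_ord_recr /= bp0 bp1 mul0n addn0 mul1n.
by rewrite [fib p.+4]fibSS addnC ltn_add2l.
Qed.

Lemma zeck_sum_lt1 b p : zeck_digits b -> b p = 1%N ->
  (\sum_(i < p) b i * fib i.+2 < fib p.+1)%N.
Proof.
move=> bZ; case: p => [|p] bp; first by rewrite big_ord0.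
case: (bZ) => _ /(_ p) [bp0|]; last by rewrite bp.
by rewrite big_ord_recr /= bp0 mul0n addn0 zeck_sum_lt.
Qed.

(** Greedy expansion. Position [p - 1] is left empty so that a 1 can be placed at [p]. *)
Lemma zeck_low_exists p m : (m < fib p.+1)%N ->
  exists b, [/\ zeck_digits b, (forall i, p <= i.+1 -> b i = 0)%N
              & m = (\sum_(i < p) b i * fib i.+2)%N].
Proof.
elim/ltn_ind: p m => -[|[|p]] IH m.
- case: m => // _; exists (fun=> 0%N); split=> //; first exact: zeck_digits0.
  by rewrite big_ord0.
- case: m => // _; exists (fun=> 0%N); split=> //; first exact: zeck_digits0.
  by rewrite big_ord_recl big_ord0.
case: (ltnP m (fib p.+2)) => [lt_m _|le_m lt_m].
  have [//|b [bZ b0 ->]] := IH p.+1 _ m lt_m.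
  exists b; split=> // [i lei|]; first by apply: b0; lia.
  by rewrite [RHS]big_ord_recr /= (b0 p.+1) // mul0n addn0.
have [||b [bZ b0 bE]] := IH p _ (m - fib p.+2)%N; first by lia.
  by rewrite [fib p.+3]fibSS in lt_m; lia.
exists (splice p b (digit_cons 1 (fun=> 0%N))); split.
- apply: zeck_digits_splice => //.
  by apply: zeck_digits_cons => //; [exact: zeck_digits0 | right].
- move=> i lei; rewrite /splice ifF; last lia.
  by have : (0 < i - p)%N; [lia | case: (i - p)%N].
rewrite -addn2 (sum_splice _ _ _ _ (fun i => fib i.+2)) -bE.
by rewrite 2!big_ord_recl big_ord0 /= !addn0 mul1n subnK.
Qed.

Lemma golden_lt2 (R : realFieldType) (f : R) : 1 < f -> f * f = f + 1 -> f < 2.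
Proof.
move=> f_gt1 f_sqr.
rewrite ltNge; apply/negP => f2.
have : 0 <= (f - 2) * (f - 1) by apply: mulr_ge0; lra.
by rewrite mulrBl !mulrBr; lra.
Qed.

(** If [u] is the value of the digits with the lowest one removed, then [s = (1 - f) * (b 0 + u)],
    where [1 - f] is the conjugate of [f]. Lowest digit 0 gives the window ]f - 2, f -
    1[. Lowest digit 1 gives ]-1, f - 2[, because the third bound then applies to [u]. *)
Lemma zeck_sum_range (R : realFieldType) (f : R) b N :
  1 < f -> f * f = f + 1 -> zeck_digits b ->
  let s := (\sum_(i < N) b i * fib i.+2)%N%:R
           - (\sum_(i < N) b i * fib i.+1)%N%:R * f in
  [/\ -1 < s, s < f - 1 & b 0%N = 0%N -> f - 2 < s].
Proof.
move=> f_gt1 f_sqr; have f2 := golden_lt2 f_gt1 f_sqr.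
elim: N b => [|N IH] b bZ s.
  by rewrite /s !big_ord0 mul0r subr0 {s}; split=> *; lra.
have bZ1 : zeck_digits (fun i => b i.+1) by case: bZ => ? ?; split.
have := IH _ bZ1; rewrite /s !big_ord_recl /= !muln1.
set Y := (\sum_(i < N) b i.+1 * fib i.+2)%N.
set X := (\sum_(i < N) b i.+1 * fib i.+1)%N => -[s1 s2 s3] {s}.
rewrite (sum_fibSS N (fun i => b i.+1) S) -/X -/Y.
rewrite !natrD; case: bZ => bdig /(_ 0%N) bsep.
have -> : (b 0%N)%:R + (Y%:R + X%:R) - ((b 0%N)%:R + Y%:R) * f =
          (1 - f) * ((b 0%N)%:R + (Y%:R - X%:R * f)).
  by ring: f_sqr.
move: (Y%:R - _) s1 s2 s3 => u u1 u2 u3.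
have h1 : 0 < (f - 1) * (u + 1) by apply: mulr_gt0; lra.
have h2 : 0 < (f - 1) * (f - 1 - u) by apply: mulr_gt0; lra.
have [b0|b0] : b 0%N = 0%N \/ b 0%N = 1%N.
  by have := bdig 0%N; case: (b 0%N) => [|[|]]; auto.
  by rewrite b0; split=> [||_]; lra.
case: bsep => [|b10]; first by rewrite b0.
have {}u3 := u3 b10.
by rewrite b0; split=> [||//]; lra.
Qed.

(** The lowest digit [e] is read off by comparison with [f - 2], where the windows of the digits 0
    and 1 meet; the remaining pair is [(y - x, x - e)]. Non-strict bounds are kept because the cut
    [f - 2] is sent to the endpoint [f - 1]. *)
Lemma zeck_tail_exists (R : realFieldType) (f : R) (x y : nat) :
  1 < f -> f * f = f + 1 ->
  -1 <= y%:R - x%:R * f -> y%:R - x%:R * f <= f - 1 ->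
  exists b N, [/\ zeck_digits b, (forall i, N <= i -> b i = 0)%N,
    x = (\sum_(i < N) b i * fib i.+1)%N, y = (\sum_(i < N) b i * fib i.+2)%N
    & f - 2 <= y%:R - x%:R * f -> b 0%N = 0%N].
Proof.
move=> f_gt1 f_sqr; have f2 := golden_lt2 f_gt1 f_sqr.
have [n] := ubnP (x + y)%N.
elim: n x y => // n IH x y lt_n s1 s2.
have [x0|x_gt0] := posnP x.
  have y0 : y = 0%N.
    apply/eqP; rewrite -leqn0 -ltnS -(ltr_nat R).
    by move: s1 s2; rewrite x0; lra.
  exists (fun=> 0%N), 0%N; rewrite x0 y0 !big_ord0; split=> //.
  exact: zeck_digits0.
have le_xy : (x <= y)%N.
  rewrite -ltnS -(ltr_nat R) -(natr1 y).
  have : 1 <= x%:R :> R by rewrite ler1n.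
  by nra.
pose e : nat := if f - 2 <= y%:R - x%:R * f then 0%N else 1%N.
have ex : (e <= x)%N by rewrite /e; case: ifP.
have e1 : (e <= 1)%N by rewrite /e; case: ifP.
(* This inverts [s = (1 - f) * (e + s')], as [f * (1 - f) = -1]. *)
have E : (x - e)%N%:R - (y - x)%N%:R * f = - e%:R - f * (y%:R - x%:R * f).
  by rewrite !natrB //; ring: f_sqr.
have [|||b [N [bZ bN EX EY b0]]] := IH (y - x)%N (x - e)%N.
- lia.
- rewrite E /e; case: ifP => hs.
    have : 0 <= f * (f - 1 - (y%:R - x%:R * f)) by apply: mulr_ge0; lra.
    lra.
  have : 0 < f * (f - 2 - (y%:R - x%:R * f)) by apply: mulr_gt0; lra.
  lra.
- rewrite E /e; case: ifP => hs.
    have : 0 <= f * (y%:R - x%:R * f - (f - 2)) by apply: mulr_ge0; lra.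
    lra.
  have : 0 <= f * (y%:R - x%:R * f + 1) by apply: mulr_ge0; lra.
  lra.
exists (digit_cons e b), N.+1; split.
- apply: zeck_digits_cons => //; move: b0; rewrite E /e.
  case: ifP => hs; first by left.
  move=> b0; right; apply: b0.
  have : 0 < f * (f - 2 - (y%:R - x%:R * f)) by apply: mulr_gt0; lra.
  lra.
- by case=> // i; exact: bN.
- by rewrite big_ord_recl /= muln1 -EY subnKC.
- by rewrite big_ord_recl /= muln1 (sum_fibSS N b S) -EX -EY; lia.
- by move=> hs; rewrite /= /e hs.
Qed.

(** * Chung-Graham digits *)

(* Digit [i] of a Chung-Graham sequence is the coefficient of [fib i.*2.+2]. *)
Definition cg_digits (d : nat -> nat) : Prop :=
  (forall i, d i <= 2)%N /\
  (forall i j, (i < j)%N -> d i = 2 -> d j = 2 ->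
     exists2 l, (i < l < j)%N & d l = 0%N).

(* [d] may follow digits among which a 2 is still waiting for its 0. *)
Definition zero_before_two (d : nat -> nat) : Prop :=
  forall j, d j = 2 -> exists2 l, (l < j)%N & d l = 0%N.

Definition zero_after_two (d : nat -> nat) (q : nat) : Prop :=
  forall i, (i < q)%N -> d i = 2 -> exists2 l, (i < l < q)%N & d l = 0%N.

Lemma chung_graham_digits n c : chung_graham_decomposition n c ->
  cg_digits (fun i => c i.+1) /\
  exists2 N, (forall i, N <= i -> c i.+1 = 0)%N &
    n = (\sum_(i < N) c i.+1 * fib i.*2.+2)%N.
Proof.
case=> cdig csep [N c0 ->]; split; first split => [i|i j lt_ij ci cj].
- by have := cdig i.+1 isT; rewrite !inE => /or3P[] /eqP->.
- have [//|//|[//|l] lt_l cl] := csep i.+1 j.+1 _ _ ci cj.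
  by exists l.
exists N.-1 => [i leNi|]; first by apply: c0; lia.
by rewrite big_add1 big_mkord; apply: eq_bigr => i _; rewrite mul2n.
Qed.

Lemma digits_chung_graham d N : cg_digits d ->
  (forall i, N <= i -> d i = 0)%N ->
  chung_graham_decomposition (\sum_(i < N) d i * fib i.*2.+2)
    (fun i => d i.-1).
Proof.
move=> [ddig dsep] d0; split.
- by move=> i _; rewrite !inE; have := ddig i.-1; case: (d _) => [|[|[]]].
- move=> [|i] [|j] // _ lt_ij di dj; have [l lt_l dl] := dsep i j lt_ij di dj.
  by exists l.+1.
exists N.+1 => [i leNi|]; first by apply: d0; lia.
by rewrite big_add1 big_mkord; apply: eq_bigr => i _; rewrite mul2n.
Qed.

Lemma cg_digits0 : cg_digits (fun=> 0%N).
Proof. by []. Qed.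

Lemma cg_digits_cons x d : cg_digits d -> (x <= 2)%N ->
  (x = 2 -> zero_before_two d) -> cg_digits (digit_cons x d).
Proof.
move=> [ddig dsep] x2 xd; split.
  by case.
move=> [|i] [|j] //=.
  by move=> _ di dj; have [l lt_l dl] := xd di j dj; exists l.+1.
by move=> lt_ij di dj; have [l lt_l dl] := dsep i j lt_ij di dj; exists l.+1.
Qed.

Lemma zero_before_two_cons0 d : zero_before_two (digit_cons 0 d).
Proof. by move=> [|j] //= _; exists 0%N. Qed.

Lemma zero_before_two_cons1 d :
  zero_before_two d -> zero_before_two (digit_cons 1 d).
Proof. by move=> dz [|j] //= /dz [l lt_l dl]; exists l.+1. Qed.

(** The 0 between a 2 below [q] and a 2 above it can be supplied by either side. *)
Lemma cg_digits_splice q c d : cg_digits c -> cg_digits d ->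
  zero_before_two d \/ zero_after_two c q -> cg_digits (splice q c d).
Proof.
move=> [cdig csep] [ddig dsep] gap; split=> [i|i j lt_ij]; rewrite /splice.
  by case: ifP.
case: (ltnP i q) => [lt_iq|le_qi] ci; case: (ltnP j q) => [lt_jq|le_qj] cj.
- have [l /andP[lt_il lt_lj] cl] := csep i j lt_ij ci cj.
  by exists l; [rewrite lt_il | rewrite (ltn_trans lt_lj)].
- case: gap => [dz|cz].
    have [l lt_l dl] := dz _ cj; exists (q + l)%N; first lia.
    by rewrite ltnNge leq_addr addKn.
  have [l /andP[lt_il lt_lq] cl] := cz i lt_iq ci; exists l; first lia.
  by rewrite lt_lq.
- lia.
- have [|l lt_l dl] := dsep (i - q)%N (j - q)%N _ ci cj; first lia.
  exists (q + l)%N; first lia.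
  by rewrite ltnNge leq_addr addKn.
Qed.

(** The two bounds are proved together: a top digit 2 makes the digits below it satisfy
    [zero_after_two], and the sharper bound there compensates for the larger digit. *)
Lemma cg_sum_lt d q : cg_digits d ->
  (\sum_(i < q) d i * fib i.*2.+2 < fib q.*2.+2)%N /\
  (zero_after_two d q -> \sum_(i < q) d i * fib i.*2.+2 < fib q.*2.+1)%N.
Proof.
move=> [ddig dsep]; elim: q => [|q [IH IHz]]; first by rewrite big_ord0.
rewrite big_ord_recr /= doubleS !fibSS.
move: IH IHz (fib_gt0 q.*2); rewrite fibSS.
move: (\sum_(i < q) _)%N (fib q.*2.+1) (fib q.*2) => S A B IH IHz A_gt0.
have [dq|[dq|dq]] : d q = 0%N \/ d q = 1%N \/ d q = 2%N.
- by have := ddig q; case: (d q) => [|[|[|]]]; auto.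
- by rewrite dq; split=> *; lia.
- rewrite dq; split=> [|dz]; first lia.
  suff /IHz : zero_after_two d q by lia.
  move=> i lt_iq di; have [|l lt_l dl] := dz i _ di; first lia.
  exists l => //; suff : l <> q by lia.
  by move=> lq; rewrite lq dq in dl.
rewrite dq; split=> [|/(_ q (ltnSn q) dq) [l]]; last lia.
suff /IHz : zero_after_two d q by lia.
by move=> i lt_iq di; apply: dsep.
Qed.

Lemma cg_low_exists q m : (m < fib q.*2.+2)%N ->
  exists c, [/\ cg_digits c, (forall i, q <= i -> c i = 0)%N,
    m = (\sum_(i < q) c i * fib i.*2.+2)%N
    & (m < fib q.*2.+1)%N -> zero_after_two c q].
Proof.
elim: q m => [|q IH] m lt_m.
  case: m lt_m => // _; exists (fun=> 0%N); split=> //.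
  by rewrite big_ord0.
have gt0 := fib_gt0 q.*2; move: lt_m; rewrite doubleS !fibSS => lt_m.
(* Induction step for an arbitrary top digit [v] and remainder [r]; the greedy choice of [v] is then
   a three-case computation. *)
have step v r : (v <= 2)%N -> m = (v * fib q.*2.+2 + r)%N ->
    (r < fib q.*2.+2)%N -> (v = 2 -> r < fib q.*2.+1)%N ->
    (m < fib q.*2.+3 -> v = 0 \/ v = 1 /\ r < fib q.*2.+1)%N ->
  exists c, [/\ cg_digits c, (forall i, q < i -> c i = 0)%N,
    m = (\sum_(i < q.+1) c i * fib i.*2.+2)%N
    & (m < fib q.*2.+3)%N -> zero_after_two c q.+1].
  move=> v2 mE lt_r rv vm; have [c [cC c0 rE cz]] := IH _ lt_r.
  have d0 : cg_digits (digit_cons v (fun=> 0%N)).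
    by apply: cg_digits_cons => //; exact: cg_digits0.
  exists (splice q c (digit_cons v (fun=> 0%N))); split.
  - apply: cg_digits_splice => //.
    case: (eqVneq v 2) => [ev|nv]; first by right; apply: cz; apply: rv.
    by left=> -[|j] //= ev; rewrite ev in nv.
  - move=> i lt_qi; rewrite /splice ifF; last lia.
    by have : (0 < i - q)%N; [lia | case: (i - q)%N].
  - rewrite -addn1 (sum_splice _ _ _ _ (fun i => fib i.*2.+2)) -rE.
    by rewrite big_ord_recl big_ord0 /= !addn0 addnC.
  move=> /vm hv i; rewrite ltnS leq_eqVlt => /orP[/eqP->|lt_iq].
    by rewrite /splice ltnn subnn /=; case: hv => [->|[->]].
  rewrite /splice lt_iq => ci; case: hv => [v0|[_ /cz /(_ i lt_iq ci)]].
    by exists q; rewrite ?lt_iq ?leqnn // ltnn subnn.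
  move=> [l /andP[lt_il lt_lq] cl]; exists l; last by rewrite lt_lq.
  by rewrite lt_il (ltn_trans lt_lq).
move: step lt_m gt0; rewrite !fibSS {IH}.
move: (fib q.*2.+1) (fib q.*2) => A B step lt_m A_gt0.
case: (ltnP m (A + B)) => [lt0|ge0].
  by apply: (step 0%N m) => //; left.
case: (ltnP m (A + B + (A + B))) => [lt1|ge1].
  apply: (step 1%N (m - (A + B))%N) => //; [lia|lia|].
  by move=> lt_m'; right; split=> //; lia.
by apply: (step 2%N (m - (A + B + (A + B)))%N) => // [||_|]; lia.
Qed.

(** Effect of putting a digit [d] below a tail with sums [X] and [Y]. The factor [2 - f] is the
    square of the conjugate [1 - f], since the index moves by two. *)
Lemma cg_window_shift (R : realFieldType) (f d X Y : R) : f * f = f + 1 ->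
  (d + (Y + X)) * f - (d + ((Y + X) + Y)) =
  d * (f - 1) + (2 - f) * (X * f - Y).
Proof. by move=> f_sqr; ring: f_sqr. Qed.

(** Each lowest digit adds [f - 1] per unit to a tail scaled by [2 - f]. A lowest digit 2 stays
    below [f] because its tail must satisfy [zero_before_two], hence has value below 1. *)
Lemma cg_sum_range (R : realFieldType) (f : R) d N :
  1 < f -> f * f = f + 1 -> cg_digits d ->
  let t := (\sum_(i < N) d i * fib i.*2.+1)%N%:R * f
           - (\sum_(i < N) d i * fib i.*2.+2)%N%:R in
  [/\ 0 <= t, t < f & zero_before_two d -> t < 1].
Proof.
move=> f_gt1 f_sqr; have f2 := golden_lt2 f_gt1 f_sqr.
elim: N d => [|N IH] d dC t.
  by rewrite /t !big_ord0 mul0r subr0 {t}; split=> *; lra.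
have dC1 : cg_digits (fun i => d i.+1).
  case: dC => ddig dsep; split=> // i j lt_ij di dj.
  by have [//|[//|l] lt_l dl] := dsep i.+1 j.+1 _ di dj; exists l.
have := IH _ dC1; rewrite /t !big_ord_recl /= !muln1.
rewrite (sum_fibSS N (fun i => d i.+1) (fun i => i.*2.+2)).
rewrite (sum_fibSS N (fun i => d i.+1) (fun i => i.*2.+1)).
set Y := (\sum_(i < N) d i.+1 * fib i.*2.+2)%N.
set X := (\sum_(i < N) d i.+1 * fib i.*2.+1)%N => -[t1 t2 t3] {t}.
rewrite !natrD cg_window_shift //.
move: (X%:R * f - _) t1 t2 t3 => u u1 u2 u3.
have h1 : 0 <= (2 - f) * u by apply: mulr_ge0; lra.
have h2 : 0 < (2 - f) * (f - u) by apply: mulr_gt0; lra.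
case: dC => ddig dsep.
have [d0|[d0|d0]] : d 0%N = 0%N \/ d 0%N = 1%N \/ d 0%N = 2.
- by have := ddig 0%N; case: (d 0%N) => [|[|[|]]]; auto.
- by rewrite d0; split=> [||_]; lra.
- rewrite d0; split=> [||dz]; [lra|lra|].
  have {}u3 : u < 1.
    apply: u3 => j /dz [[|l] lt_l dl]; first by rewrite d0 in dl.
    by exists l.
  have : 0 < (2 - f) * (1 - u) by apply: mulr_gt0; lra.
  lra.
have {}u3 : u < 1.
  apply: u3 => j dj; have [//|[|l] lt_l dl] := dsep 0%N j.+1 _ d0 dj.
    by rewrite d0 in dl.
  by exists l.
have h3 : 0 < (2 - f) * (1 - u) by apply: mulr_gt0; lra.
rewrite d0; split=> [||dz]; [lra|lra|].
by have [[|l]] := dz 0%N d0.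
Qed.

Lemma cg_tail_exists (R : realFieldType) (f : R) (x y : nat) :
  1 < f -> f * f = f + 1 ->
  0 <= x%:R * f - y%:R -> x%:R * f - y%:R < f ->
  exists d N, [/\ cg_digits d, (forall i, N <= i -> d i = 0)%N,
    x = (\sum_(i < N) d i * fib i.*2.+1)%N,
    y = (\sum_(i < N) d i * fib i.*2.+2)%N
    & x%:R * f - y%:R < 1 -> zero_before_two d].
Proof.
move=> f_gt1 f_sqr; have f2 := golden_lt2 f_gt1 f_sqr.
(* Hence [1 < 2 * (f - 1)]: a value below 1 never calls for a lowest digit 2. *)
have f32 : 3 / 2 < f.
  rewrite ltNge; apply/negP => le_f.
  have : 0 <= (f - 1) * (3 / 2 - f) by apply: mulr_ge0; lra.
  by lra.
have [n] := ubnP x.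
elim: n x y => // n IH x y lt_n t1 t2.
have [x0|x_gt0] := posnP x.
  have y0 : y = 0%N.
    apply/eqP; rewrite -leqn0 -(ler_nat R).
    by move: t1 t2; rewrite x0; lra.
  exists (fun=> 0%N), 0%N; rewrite x0 y0 !big_ord0; split=> //.
have le_xy : (x <= y)%N.
  rewrite -ltnS -(ltr_nat R) -(natr1 y).
  have x1 : 1 <= x%:R :> R by rewrite ler1n.
  have : 0 <= (f - 1) * (x%:R - 1) by apply: mulr_ge0; lra.
  by lra.
have [t tE] : exists t, t = x%:R * f - y%:R by exists (x%:R * f - y%:R).
rewrite -!tE in t1 t2 *.
(* Greedy lowest digit: the number of copies of [f - 1], at most two, that fit in [t]. *)
have [e eP] : exists e : nat, [\/ e = 0%N /\ t < f - 1,
    [/\ e = 1%N, f - 1 <= t & t < 2 * (f - 1)] | e = 2%N /\ 2 * (f - 1) <= t].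
  case: (ltP t (f - 1)) => h1; first by exists 0%N; constructor 1.
  case: (ltP t (2 * (f - 1))) => h2; first by exists 1%N; constructor 2.
  by exists 2%N; constructor 3.
have e2 : (e <= 2)%N by case: eP => -[->].
(* Value of the remaining tail: [cg_window_shift] solved for it, using [(f + 1) * (2 - f) = 1] and
   [(f + 1) * (f - 1) = f]. *)
have [t' t'E] : exists t', t' = (f + 1) * t - e%:R * f.
  by exists ((f + 1) * t - e%:R * f).
have [t'0 t'f t'1] :
    [/\ 0 <= t', t' < f & e = 2%N \/ t < 1 /\ e = 1%N -> t' < 1].
  rewrite t'E; case: eP => [[-> h1]|[-> h1 h2]|[-> h1]].
  - have h3 : 0 <= (f + 1) * t by apply: mulr_ge0; lra.
    have h4 : 0 < (f + 1) * (f - 1 - t) by apply: mulr_gt0; lra.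
    by split=> [||[|[]]//]; lra.
  - have h3 : 0 <= (f + 1) * (t - (f - 1)) by apply: mulr_ge0; lra.
    have h4 : 0 < (f + 1) * (2 * (f - 1) - t) by apply: mulr_gt0; lra.
    split=> [||[//|[lt1 _]]]; [lra|lra|].
    have h5 : 0 < (f + 1) * (1 - t) by apply: mulr_gt0; lra.
    by lra.
  - have h3 : 0 <= (f + 1) * (t - 2 * (f - 1)) by apply: mulr_ge0; lra.
    have h4 : 0 < (f + 1) * (f - t) by apply: mulr_gt0; lra.
    by split=> [||_]; lra.
have E : (2 * x%:R - y%:R - e%:R) * f - (y%:R - x%:R) = t'.
  by rewrite t'E tE; ring: f_sqr.
(* The new first coordinate [2 * x - (y + e)] is not truncated: were it negative, [t'] would be
   negative too. *)
have le_ex : (y + e <= 2 * x)%N.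
  rewrite -(ler_nat R) natrD natrM leNgt; apply/negP => lt0.
  have yx : x%:R <= y%:R :> R by rewrite ler_nat.
  have : 0 < f * (y%:R + e%:R - 2 * x%:R) by apply: mulr_gt0; lra.
  by lra.
(* The measure drops unless [y = x] and [e = 0], but then [t = x * (f - 1)] is at least [f - 1],
   against the choice of [e]. *)
have ltx : (2 * x - (y + e) < x)%N.
  suff : (x < y + e)%N by clear -x_gt0 le_ex; lia.
  rewrite ltn_neqAle (leq_trans le_xy) ?leq_addr // andbT.
  apply/negP => /eqP xE.
  have [yx e0] : y = x /\ e = 0%N by clear -le_xy xE; lia.
  have x1 : 1 <= x%:R :> R by rewrite ler1n.
  have h : 0 <= (f - 1) * (x%:R - 1) by apply: mulr_ge0; lra.
  case: eP => [[_ h1]|[]|[]]; rewrite ?e0 //.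
  by rewrite tE yx in h1; lra.
have E' : (2 * x - (y + e))%N%:R * f - (y - x)%N%:R = t'.
  by rewrite -E !natrB // natrD natrM; ring.
have [|||d [N [dC dN EX EY dz]]] := IH (2 * x - (y + e))%N (y - x)%N.
- by clear -lt_n ltx; lia.
- by rewrite E'.
- by rewrite E'.
rewrite E' in dz; exists (digit_cons e d), N.+1; split.
- by apply: cg_digits_cons => // ee; apply/dz/t'1; left.
- by case=> // i; exact: dN.
- rewrite big_ord_recl /= muln1 (sum_fibSS N d (fun i => i.*2.+1)) -EX -EY.
  by clear -le_ex le_xy; lia.
- rewrite big_ord_recl /= muln1 (sum_fibSS N d (fun i => i.*2.+2)).
  rewrite (sum_fibSS N d (fun i => i.*2.+1)) -EX -EY.
  by clear -le_ex le_xy; lia.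
move=> lt1; case: eP t'1 => [[-> _] _|[-> _ _] t'1|[_ h1]].
- exact: zero_before_two_cons0.
- by apply: zero_before_two_cons1; apply: dz; apply: t'1; right.
by lra.
Qed.

(** * Splitting a decomposition at [fib (2 * k)] *)

Lemma zeck_split (R : realFieldType) (f : R) m a p :
  1 < f -> f * f = f + 1 ->
  zeckendorf_decomposition m a -> a p.+2 != 0%N ->
  exists l x y, [/\ (l < fib p.+1)%N,
    m = (l + x.+1 * fib p.+2 + y * fib p.+3)%N,
    -1 < y%:R - x%:R * f & y%:R - x%:R * f < f - 1].
Proof.
move=> f_gt1 f_sqr /zeckendorf_digits[bZ [N b0 ->]] ap0.
set b := (fun i => a i.+2) in bZ b0 *.
have bp1 : b p = 1%N.
  by have := bZ.1 p; move: ap0; rewrite /b; case: (a _) => [|[]].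
have bp0 : b p.+1 = 0%N by case: (bZ.2 p) => //; rewrite bp1.
(* The tail starts two positions above [p], since digit [p.+1] is 0. *)
pose d i := b (p.+2 + i)%N.
have dZ : zeck_digits d.
  by split=> i; [exact: bZ.1 | rewrite /d addnS; exact: bZ.2].
have [s1 s2 _] := zeck_sum_range N f_gt1 f_sqr dZ.
exists (\sum_(i < p) b i * fib i.+2)%N, (\sum_(i < N) d i * fib i.+1)%N,
  (\sum_(i < N) d i * fib i.+2)%N; split=> //; first exact: zeck_sum_lt1.
rewrite -(sum_pad (fun i => fib i.+2) b0 (leq_addl p.+2 N)).
rewrite (sum_shift _ _ b (fun i => fib i.+2)) 2!big_ord_recr /= bp1 bp0.
have -> : (\sum_(i < N) b (p.+2 + i) * fib (p.+2 + i).+2 =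
  \sum_(i < N) d i * fib (p.+2 + i.+2))%N.
  by apply: eq_bigr => i _; rewrite !addnS.
by rewrite (sum_fib_add p.+2 N d S) mulSn; ring.
Qed.

(** The digits 1 and 0 are inserted at [p] and [p.+1]; the 0 lets the tail start with either
    digit. *)
Lemma zeck_join (R : realFieldType) (f : R) l x y p :
  1 < f -> f * f = f + 1 -> (l < fib p.+1)%N ->
  -1 <= y%:R - x%:R * f -> y%:R - x%:R * f <= f - 1 ->
  exists2 a, zeckendorf_decomposition (l + x.+1 * fib p.+2 + y * fib p.+3) a
           & a p.+2 != 0%N.
Proof.
move=> f_gt1 f_sqr lt_l s1 s2.
have [c [cZ c0 ->]] := zeck_low_exists lt_l.
have [d [N [dZ dN -> -> _]]] := zeck_tail_exists f_gt1 f_sqr s1 s2.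
pose b := splice p c (digit_cons 1 (digit_cons 0 d)).
exists (fun i => b i.-2); last by rewrite /b /splice ltnn subnn.
have bZ : zeck_digits b.
  apply: zeck_digits_splice => //; apply: zeck_digits_cons; try by [|right].
  by apply: zeck_digits_cons => //; left.
have b0 i : (p + N.+2 <= i)%N -> b i = 0%N.
  move=> le_i; rewrite /b /splice ifF; last lia.
  have : (N.+2 <= i - p)%N by lia.
  by case: (i - p)%N => [|[|j]] //= /dN.
have := digits_zeckendorf bZ b0; congr zeckendorf_decomposition.
rewrite /b (sum_splice _ _ _ _ (fun i => fib i.+2)) 2!big_ord_recl /=.
have -> : (\sum_(i < N) d i * fib (p + i.+2).+2 =
  \sum_(i < N) d i * fib (p.+2 + i.+2))%N.
  by apply: eq_bigr => i _; rewrite !addnS !addSn.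
by rewrite (sum_fib_add p.+2 N d S) addn0 mulSn; ring.
Qed.

Lemma cg_split (R : realFieldType) (f : R) m c q :
  1 < f -> f * f = f + 1 ->
  chung_graham_decomposition m c -> c q.+1 != 0%N ->
  exists l x y, [/\ m = (l + x.+1 * fib q.*2.+2 + y * fib q.*2.+3)%N,
    0 <= x%:R * f - y%:R, x%:R * f - y%:R < f &
    (l < fib q.*2.+1)%N \/ (l < fib q.*2.+3)%N /\ x%:R * f - y%:R < 1].
Proof.
move=> f_gt1 f_sqr /chung_graham_digits[bC [N b0 ->]] cq0.
set b := (fun i => c i.+1) in bC b0 *.
pose d i := b (q.+1 + i)%N.
have dC : cg_digits d.
  split=> [i|i j lt_ij di dj]; first exact: bC.1.
  have [|l lt_l bl] := bC.2 _ _ _ di dj; first by rewrite ltn_add2l.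
  exists (l - q.+1)%N; first lia.
  by rewrite /d subnKC //; lia.
have [t1 t2 t3] := cg_sum_range N f_gt1 f_sqr dC.
have [L1 L2] := cg_sum_lt q bC.
(* Only one copy of [fib q.*2.+2] is counted in [x.+1]; a second one, when digit [q] is 2, goes into
   the low part. *)
exists ((b q).-1 * fib q.*2.+2 + \sum_(i < q) b i * fib i.*2.+2)%N,
  (\sum_(i < N) d i * fib i.*2.+1)%N, (\sum_(i < N) d i * fib i.*2.+2)%N.
split=> //.
- rewrite -(sum_pad (fun i => fib i.*2.+2) b0 (leq_addl q.+1 N)).
  rewrite (sum_shift _ _ b (fun i => fib i.*2.+2)) big_ord_recr /=.
  have -> : (\sum_(i < N) b (q.+1 + i) * fib (q.+1 + i).*2.+2 =
    \sum_(i < N) d i * fib (q.*2.+2 + i.*2.+2))%N.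
    by apply: eq_bigr => i _; rewrite doubleD doubleS !addnS.
  rewrite (sum_fib_add q.*2.+2 N d (fun i => i.*2.+1)).
  have -> : b q = (b q).-1.+1 by rewrite prednK // lt0n.
  by rewrite !mulSn /=; ring.
have [bq|bq] : b q = 1%N \/ b q = 2.
- by have := bC.1 q; move: cq0; rewrite /b; case: (c _) => [|[|[|]]]; auto.
- rewrite bq mul0n add0n; have [dz|ndz] := pselect (zero_before_two d).
    right; split; last exact: t3.
    by rewrite fibSS (leq_trans L1) ?leq_addr.
  (* Some 2 of the tail has no 0 before it in the tail, and digit [q] is 1, so every 2 below [q]
     must meet its 0 below [q]. *)
  left; apply: L2 => i lt_iq bi; apply: contrapT => nl; apply: ndz => j dj.
  have [|l lt_l bl] := bC.2 i (q.+1 + j)%N _ bi dj; first lia.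
  have lt_ql : (q < l)%N.
    rewrite ltnNge leq_eqVlt; apply/negP => /orP[/eqP lq|lt_lq].
      by rewrite lq bq in bl.
    by apply: nl; exists l => //; lia.
  by exists (l - q.+1)%N; [lia | rewrite /d subnKC].
(* With digit [q] equal to 2, a 0 separates it from any 2 on either side, so both sharper bounds
   hold. *)
right; split.
  rewrite bq mul1n fibSS ltn_add2l; apply: L2 => i lt_iq bi.
  exact: bC.2 lt_iq bi bq.
apply: t3 => j dj.
have [|l lt_l bl] := bC.2 q (q.+1 + j)%N _ bq dj; first lia.
by exists (l - q.+1)%N; [lia | rewrite /d subnKC //; lia].
Qed.

(** A value below 1 yields a tail with [zero_before_two]; this survives the digit 1 put at [q], so
    arbitrary low digits may precede. *)
Lemma cg_join (R : realFieldType) (f : R) l x y q :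
  1 < f -> f * f = f + 1 -> (l < fib q.*2.+2)%N ->
  0 <= x%:R * f - y%:R -> x%:R * f - y%:R < 1 ->
  exists2 c, chung_graham_decomposition
               (l + x.+1 * fib q.*2.+2 + y * fib q.*2.+3) c
           & c q.+1 != 0%N.
Proof.
move=> f_gt1 f_sqr lt_l t1 t2.
have [c [cC c0 -> _]] := cg_low_exists lt_l.
have [d [N [dC dN xE yE /(_ t2) dz]]] :=
  cg_tail_exists f_gt1 f_sqr t1 (lt_trans t2 f_gt1).
rewrite xE yE {xE yE t1 t2}.
pose b := splice q c (digit_cons 1 d).
exists (fun i => b i.-1); last by rewrite /b /splice ltnn subnn.
have bC : cg_digits b.
  apply: cg_digits_splice => //; first exact: cg_digits_cons.
  by left; apply: zero_before_two_cons1.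
have b0 i : (q + N.+1 <= i)%N -> b i = 0%N.
  move=> le_i; rewrite /b /splice ifF; last lia.
  have : (N.+1 <= i - q)%N by lia.
  by case: (i - q)%N => [|j] //= /dN.
have := digits_chung_graham bC b0; congr chung_graham_decomposition.
rewrite /b (sum_splice _ _ _ _ (fun i => fib i.*2.+2)) big_ord_recl /=.
have -> : (\sum_(i < N) d i * fib (q + i.+1).*2.+2 =
  \sum_(i < N) d i * fib (q.*2.+2 + i.*2.+2))%N.
  by apply: eq_bigr => i _; rewrite doubleD doubleS !addnS.
by rewrite (sum_fib_add q.*2.+2 N d (fun i => i.*2.+1)) addn0 mulSn; ring.
Qed.

(* [l, x, y] come from the Zeckendorf splitting, [l', x', y'] from the
   Chung-Graham one; a positive [y - x f] would make the sizes of [y - y'] and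
   [x - x'] incompatible with the equality. *)
Lemma split_window_le0 (R : realFieldType) (f : R) p (l x y l' x' y' : nat) :
  1 < f -> f * f = f + 1 ->
  (l + x.+1 * fib p.+2 + y * fib p.+3 =
   l' + x'.+1 * fib p.+2 + y' * fib p.+3)%N ->
  (l < fib p.+1)%N ->
  y%:R - x%:R * f < f - 1 ->
  0 <= x'%:R * f - y'%:R -> x'%:R * f - y'%:R < f ->
  (l' < fib p.+1)%N \/ (l' < fib p.+3)%N /\ x'%:R * f - y'%:R < 1 ->
  y%:R - x%:R * f <= 0.
Proof.
move=> f_gt1 f_sqr mE lt_l s1 t0 t1 lt_l'; rewrite leNgt; apply/negP => s0.
(* If [x' <= x], then [y > x f >= x' f >= y'], and the left side is larger by at least
   [fib p.+3 - l'], which is positive. *)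
case: (leqP x' x) => [le_x|lt_x].
  have lt_y : (y' < y)%N.
    have : x'%:R <= x%:R :> R by rewrite ler_nat.
    rewrite -(ltr_nat R) => h.
    have : 0 <= f * (x%:R - x'%:R) by apply: mulr_ge0; lra.
    by lra.
  have : (x'.+1 * fib p.+2 <= x.+1 * fib p.+2)%N.
    by rewrite leq_mul2r ltnS le_x orbT.
  have : (y'.+1 * fib p.+3 <= y * fib p.+3)%N by rewrite leq_mul2r lt_y orbT.
  have : (l' < fib p.+3)%N.
    case: lt_l' => [h|[]//]; rewrite (leq_trans h) //.
    by rewrite (leq_trans (leq_fib _)) ?leq_fib.
  rewrite [(y'.+1 * _)%N]mulSn; move: mE; clear.
  move: (fib p.+3) (x'.+1 * _)%N (x.+1 * _)%N (y' * _)%N (y * _)%N.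
  by lia.
(* If [x < x'], the windows give [y <= y'], and the right side is larger by at least [fib p.+2 - l],
   positive as [l < fib p.+1]. *)
have h : 0 <= (f - 1) * (x'%:R - x.+1%:R).
  by apply: mulr_ge0; rewrite ?subr_ge0 ?ler_nat //; lra.
have hx : x.+1%:R <= x'%:R :> R by rewrite ler_nat.
rewrite -natr1 in h hx.
have lx : (x.+2 * fib p.+2 <= x'.+1 * fib p.+2)%N.
  by rewrite leq_mul2r ltnS lt_x orbT.
case: lt_l' => [lt_l'|[lt_l' lt1]].
  have le_y : (y <= y')%N.
    have := golden_lt2 f_gt1 f_sqr.
    by rewrite -ltnS -(ltr_nat R) -natr1; lra.
  have : (y * fib p.+3 <= y' * fib p.+3)%N by rewrite leq_mul2r le_y orbT.
  have := leq_fib p.+1; move: lx mE lt_l; rewrite [(x.+2 * _)%N]mulSn; clear.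
  move: (fib p.+1) (fib p.+2) (x'.+1 * _)%N (x.+1 * _)%N (y' * _)%N (y * _)%N.
  by lia.
have le_y : (y <= y')%N.
  by rewrite -(ler_nat R); lra.
have : (y * fib p.+3 <= y' * fib p.+3)%N by rewrite leq_mul2r le_y orbT.
have := leq_fib p.+1; move: lx mE lt_l; rewrite [(x.+2 * _)%N]mulSn; clear.
move: (fib p.+1) (fib p.+2) (x'.+1 * _)%N (x.+1 * _)%N (y' * _)%N (y * _)%N.
by lia.
Qed.

(** * The golden ratio and membership of [fib (2 * k)] *)

Lemma phi_gt1 (R : realType) : 1 < phi R.
Proof.
have : 1 < Num.sqrt 5 :> R by rewrite -[X in X < _]sqrtr1 ltr_sqrt; lra.
by rewrite /phi; lra.
Qed.

Lemma phi_sqr (R : realType) : phi R * phi R = phi R + 1.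
Proof.
have : Num.sqrt 5 ^+ 2 = 5 :> R by rewrite sqr_sqrtr.
by rewrite /phi expr2 => h5; field: h5.
Qed.

(** [Z] records values, not positions; injectivity of [fib] from index 2 on recovers the
    position. *)
Lemma mem_Z_fibP p m :
  Z m (fib p.+2) <-> exists2 a, zeckendorf_decomposition m a & a p.+2 != 0%N.
Proof.
split=> [[a aZ [[|[|i]] [// _ ai /fib_inj ip]]]|[a aZ ap]]; exists a => //.
  by rewrite ip.
by exists p.+2.
Qed.

Lemma mem_CG_fibP q m :
  CG m (fib q.*2.+2) <->
  exists2 c, chung_graham_decomposition m c & c q.+1 != 0%N.
Proof.
split=> [[c cC [[|i] [// _ ci]]]|[c cC cq]]; last first.
  by exists c => //; exists q.+1; rewrite mul2n.
rewrite mul2n => /fib_inj /double_inj iq.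
by exists c; rewrite // iq.
Qed.

Lemma mem_Z_CG_fibP (R : realType) q m :
  (Z m `&` CG m) (fib q.*2.+2) <->
  exists l x y : nat, [/\ (l < fib q.*2.+1)%N,
    m = (l + x.+1 * fib q.*2.+2 + y * fib q.*2.+3)%N
    & Num.floor (x%:R * phi R) = y%:Z].
Proof.
have phi1 := phi_gt1 R; have phi2 := phi_sqr R.
split=> [[/mem_Z_fibP[a aZ ap] /mem_CG_fibP[c cC cq]]|].
  have [l [x [y [lt_l mE s1 s2]]]] := zeck_split phi1 phi2 aZ ap.
  have [l' [x' [y' [mE' t1 t2 lt_l']]]] := cg_split phi1 phi2 cC cq.
  rewrite mE in mE'.
  have s0 := split_window_le0 phi1 phi2 mE' lt_l s2 t1 t2 lt_l'.
  exists l, x, y; split=> //; apply: floor_def.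
  by rewrite rmorphD /= -!pmulrn; apply/andP; split; lra.
move=> [l [x [y [lt_l -> /eqP]]]].
(* The floor condition puts [x phi - y] in [0, 1[, which lies inside the windows of both joins. *)
rewrite floor_eq rmorphD /= -!pmulrn => /andP[t1 t2].
split; first by apply/mem_Z_fibP/(zeck_join phi1 phi2) => //; lra.
apply/mem_CG_fibP/(cg_join phi1 phi2); try lra.
by rewrite (leq_trans lt_l) ?leq_fib.
Qed.

Theorem theorem1p4 (R : realType) (k : nat) (hk : (1 <= k)%N) :
  [set m%:Z | m in
     [set m : nat | (0 < m)%N /\ (Z m `&` CG m) (fib (2 * k))]] =
  [set x : int | exists (n : nat) (j : int),
     [/\ (1 <= n)%N,
         0 <= j <= (fib (2 * k - 1))%:Z - 1
       & x = n%:Z * (fib (2 * k))%:Z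
             + Num.floor ((n%:R - 1) * phi R) * (fib (2 * k + 1))%:Z
             + j]].
Proof.
case: k hk => // q _.
have -> : (2 * q.+1 - 1 = q.*2.+1)%N by lia.
have -> : (2 * q.+1 + 1 = q.*2.+3)%N by lia.
have -> : (2 * q.+1 = q.*2.+2)%N by lia.
apply/seteqP; split=> [_ [m [_ /(mem_Z_CG_fibP R)[l [x [y [lt_l -> fl]]]]] <-]|].
  (* The index [n] is [x + 1], so the floor is taken at [x phi]. *)
  exists x.+1, l%:Z; split=> //; first lia.
  rewrite -natr1 addrK fl; move: (fib _) (fib _) => F G.
  by rewrite !PoszD !PoszM; ring.
move=> _ [n [j [n_gt0 /andP[j_ge0 lt_j] ->]]].
case: n n_gt0 => // x _; case: j j_ge0 lt_j => // l _ lt_l.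
rewrite -natr1 addrK.
have fl0 : 0 <= Num.floor (x%:R * phi R).
  by rewrite floor_ge0 mulr_ge0 // ltW // (lt_trans ltr01) ?phi_gt1.
have [y fl] : exists y : nat, Num.floor (x%:R * phi R) = y%:Z.
  by case: (Num.floor _) fl0 => // y _; exists y.
rewrite fl.
exists (l + x.+1 * fib q.*2.+2 + y * fib q.*2.+3)%N; last first.
  move: (fib _) (fib _) => F G.
  by rewrite !PoszD !PoszM; ring.
split; last by apply/(mem_Z_CG_fibP R); exists l, x, y; split=> //; lia.
by have := fib_gt0 q.*2.+1; rewrite mulSn; lia.
Qed.
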